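(* Let $f:\mathbb{R}^n\to\mathbb{R}^n$ be a vector field which is homogeneous in the bi-limit with associated triples $(r_0,\mathfrak{d}_0,f_0)$ and $(r_\infty,\mathfrak{d}_\infty,f_\infty)$, and suppose that the origin is a globally asymptotically stable equilibrium of each of the systems $$\dot x=f(x),\qquad \dot x=f_\infty(x),\qquad \dot x=f_0(x).$$ If $\mathfrak{d}_\infty>0>\mathfrak{d}_0$, then all solutions of $\dot x=f(x)$ converge in finite time to the origin, uniformly in the initial condition; that is, there exists a real number $T>0$ such that every solution $x(\cdot)$ of $\dot x=f(x)$, whatever its initial condition $x(0)\in\mathbb{R}^n$, satisfies $x(t)=0$ for all $t\ge T$.
   Context: $\mathbb{R}_+=[0,+\infty)$. For $r=(r_1,\dots,r_n)\in(\mathbb{R}_+\setminus\{0\})^n$, $\lambda\in\mathbb{R}_+$ and $x\in\mathbb{R}^n$, $\lambda^r\diamond x=(\lambda^{r_1}x_1,\dots,\lambda^{r_n}x_n)$. A function $\phi:\mathbb{R}^n\to\mathbb{R}$ is homogeneous in the $0$-limit with associated triple $(r_0,d_0,\phi_0)$ (weight $r_0\in(\mathbb{R}_+\setminus\{0\})^n$, degree $d_0\in\mathbb{R}_+$, approximating function $\phi_0:\mathbb{R}^n\to\mathbb{R}$) if $\phi$ is continuous, $\phi_0$ is continuous and not identically zero, and for each compact set $C\subset\mathbb{R}^n\setminus\{0\}$ and each $\varepsilon>0$ there exists $\lambda_0>0$ such that $\max_{x\in C}\left|\frac{\phi(\lambda^{r_0}\diamond x)}{\lambda^{d_0}}-\phi_0(x)\right|\le\varepsilon$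 for all $\lambda\in(0,\lambda_0]$. It is homogeneous in the $\infty$-limit with associated triple $(r_\infty,d_\infty,\phi_\infty)$ if the same holds with $(r_\infty,d_\infty,\phi_\infty)$ in place of $(r_0,d_0,\phi_0)$ and ''there exists $\lambda_\infty>0$ such that ... for all $\lambda\ge\lambda_\infty$''. A vector field $f=(f_1,\dots,f_n)$ on $\mathbb{R}^n$ is homogeneous in the $0$-limit with associated triple $(r_0,\mathfrak{d}_0,f_0)$, with $r_0\in(\mathbb{R}_+\setminus\{0\})^n$, $\mathfrak{d}_0\in\mathbb{R}$ and $f_0=(f_{0,1},\dots,f_{0,n})$, if for each $i$, $\mathfrak{d}_0+r_{0,i}\ge 0$ and $f_i$ is homogeneous in the $0$-limit with associated triple $(r_0,\mathfrak{d}_0+r_{0,i},f_{0,i})$; similarly in the $\infty$-limit with $(r_\infty,\mathfrak{d}_\infty,f_\infty)$. It is homogeneous in the bi-limit if it is homogeneous in both limits; its associated triples are the two corresponding triples. *)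

(* Defs.v *)
From HB Require Import structures.
From mathcomp Require Import all_boot all_order all_algebra.
From mathcomp Require Import all_classical all_reals all_analysis.

Set Implicit Arguments.
Unset Strict Implicit.
Unset Printing Implicit Defensive.

Import Order.TTheory GRing.Theory Num.Theory.
Import numFieldNormedType.Exports.

Local Open Scope classical_set_scope.
Local Open Scope ring_scope.

Definition dilation (R : realType) (n : nat) (l : R) (r x : 'rV[R]_n) : 'rV[R]_n :=
  \row_i (l `^ (r 0 i) * x 0 i).

Definition positive_weight (R : realType) (n : nat) (r : 'rV[R]_n) : Prop :=
  forall i, 0 < r 0 i.

Definition fun_homogeneous_0limit (R : realType) (n : nat)
    (phi : 'rV[R]_n -> R) (r0 : 'rV[R]_n) (d0 : R) (phi0 : 'rV[R]_n -> R) : Prop :=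
  [/\ positive_weight r0, 0 <= d0, continuous phi,
      continuous phi0 /\ (exists x, phi0 x != 0)
    & forall C : set 'rV[R]_n, compact C -> ~ C 0 -> forall e : R, 0 < e ->
      exists2 l0 : R, 0 < l0 & forall l : R, 0 < l <= l0 ->
        forall x, C x -> `|phi (dilation l r0 x) / l `^ d0 - phi0 x| <= e].

Definition fun_homogeneous_oolimit (R : realType) (n : nat)
    (phi : 'rV[R]_n -> R) (roo : 'rV[R]_n) (doo : R) (phioo : 'rV[R]_n -> R) : Prop :=
  [/\ positive_weight roo, 0 <= doo, continuous phi,
      continuous phioo /\ (exists x, phioo x != 0)
    & forall C : set 'rV[R]_n, compact C -> ~ C 0 -> forall e : R, 0 < e ->
      exists2 loo : R, 0 < loo & forall l : R, loo <= l ->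
        forall x, C x -> `|phi (dilation l roo x) / l `^ doo - phioo x| <= e].

(* Here the degree [d0] may be negative; only each [d0 + r0 0 i] is nonnegative. *)
Definition vf_homogeneous_0limit (R : realType) (n : nat)
    (f : 'rV[R]_n -> 'rV[R]_n) (r0 : 'rV[R]_n) (d0 : R)
    (f0 : 'rV[R]_n -> 'rV[R]_n) : Prop :=
  positive_weight r0 /\
  forall i, 0 <= d0 + r0 0 i /\
    fun_homogeneous_0limit (fun x => f x 0 i) r0 (d0 + r0 0 i) (fun x => f0 x 0 i).

Definition vf_homogeneous_oolimit (R : realType) (n : nat)
    (f : 'rV[R]_n -> 'rV[R]_n) (roo : 'rV[R]_n) (doo : R)
    (foo : 'rV[R]_n -> 'rV[R]_n) : Prop :=
  positive_weight roo /\
  forall i, 0 <= doo + roo 0 i /\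
    fun_homogeneous_oolimit (fun x => f x 0 i) roo (doo + roo 0 i)
      (fun x => foo x 0 i).

Definition vf_homogeneous_bilimit (R : realType) (n : nat)
    (f : 'rV[R]_n -> 'rV[R]_n)
    (r0 : 'rV[R]_n) (d0 : R) (f0 : 'rV[R]_n -> 'rV[R]_n)
    (roo : 'rV[R]_n) (doo : R) (foo : 'rV[R]_n -> 'rV[R]_n) : Prop :=
  vf_homogeneous_0limit f r0 d0 f0 /\ vf_homogeneous_oolimit f roo doo foo.

(* The half-open time interval [0, b), with 0 < b <= +oo for a solution. *)
Definition time_domain (R : realType) (b : \bar R) : set R :=
  [set t | 0 <= t /\ (t%:E < b)%E].

(* [x : R -> 'rV_n] is total, but only its values on [0, b) are meaningful.
   Continuity at 0 together with the equation on (0, b) gives the one-sided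
   equation at 0 when [f] is continuous. *)
Definition solution (R : realType) (n : nat) (f : 'rV[R]_n -> 'rV[R]_n)
    (b : \bar R) (x : R -> 'rV[R]_n) : Prop :=
  [/\ (0 < b)%E, {within time_domain b, continuous x}
    & forall t : R, 0 < t -> (t%:E < b)%E -> is_derive t 1 x (f (x t))].

(* Right-maximality; it has to be explicit since solutions of [x' = f x] need
   not be unique for a merely continuous [f], and may blow up in finite time. *)
Definition maximal_solution (R : realType) (n : nat) (f : 'rV[R]_n -> 'rV[R]_n)
    (b : \bar R) (x : R -> 'rV[R]_n) : Prop :=
  solution f b x /\
  forall (b' : \bar R) (y : R -> 'rV[R]_n), solution f b' y -> (b <= b')%E ->
    (forall t, time_domain b t -> x t = y t) -> b' = b.

Definition stable_origin (R : realType) (n : nat)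
    (f : 'rV[R]_n -> 'rV[R]_n) : Prop :=
  forall e : R, 0 < e -> exists2 d : R, 0 < d &
    forall (b : \bar R) (x : R -> 'rV[R]_n), solution f b x -> `|x 0| < d ->
      forall t, time_domain b t -> `|x t| < e.

Definition globally_attractive_origin (R : realType) (n : nat)
    (f : 'rV[R]_n -> 'rV[R]_n) : Prop :=
  forall (b : \bar R) (x : R -> 'rV[R]_n), maximal_solution f b x ->
    b = +oo%E /\ x t @[t --> +oo] --> (0 : 'rV[R]_n).

Definition globally_asymptotically_stable_origin (R : realType) (n : nat)
    (f : 'rV[R]_n -> 'rV[R]_n) : Prop :=
  [/\ f 0 = 0, stable_origin f & globally_attractive_origin f].

(* Main.v *)
From HB Require Import structures.
From mathcomp Require Import all_boot all_order all_algebra.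
From mathcomp Require Import all_classical all_reals all_analysis.
From mathcomp Require Import ring lra.
Require Import Defs.

(** A compactness proof: no Lyapunov function is constructed.

    The heart is a statement of uniform attraction that is robust under
    perturbation of the field ([uniform_reach]).  Let [F] be a continuous field
    whose origin is globally attractive, and let [g_k] be fields converging to
    [F] uniformly on the compact sets that avoid 0.  Then the solutions of the
    [g_k], with [k] large, that start in a fixed ball must leave any closed set
    [A] avoiding 0 within a common time.  Otherwise there are solutions [y_k]
    staying in [A] during longer and longer times.  Their pointwise limit [z]
    along an ultrafilter is a solution of [F] as long as the [y_k] stay bounded;
    [z] extends to a maximal solution, which is global and tends to 0.  Hence
    [z] cannot blow up, the [y_k] stay bounded on every bounded time interval,
    and [z] remains in [A] forever while tending to 0, which is absurd.  As
    solutions of a continuous field need not be unique, the maximal extension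
    comes from Zorn's lemma.

    This is applied three times, to a solution [x] of [f].

    - Far from the origin.  If [x] solves [f] and [l > 0], then
      [s |-> dilation l^-1 r (x (l^-d s))] solves a rescaled field which tends
      to [foo] as [l] tends to infinity.  So one can find [S] such that, for [l]
      large, a solution starting in the homogeneous box of size [l] reaches the
      box of size [l / 2] within time [S * l^-d] ([contraction]).  As
      [l^-d = ((l/2)^-d - l^-d) / (2^d - 1)], the times of successive halvings
      telescope ([contraction_iter]); for [d = doo > 0] their sum is bounded
      independently of the initial box ([reach_box]).
    - Near the origin.  The same contraction holds for small [l], with limit
      field [f0].  For [d = d0 < 0] the telescoping sum of infinitely many
      halvings is bounded, so 0 itself is reached in bounded time
      ([reach_zero]).
    - In between.  With the constant sequence [g_k = f], solutions go from a
      large box to a small one in bounded time ([reach_between]).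

    Finally stability of the origin forces a solution that has reached 0 to
    remain there ([stable_origin_stays]). *)

Set Implicit Arguments.
Unset Strict Implicit.
Unset Printing Implicit Defensive.

Import Order.TTheory GRing.Theory Num.Theory.
Import numFieldNormedType.Exports.

Local Open Scope classical_set_scope.
Local Open Scope ring_scope.

(** * Row vectors coordinate by coordinate *)

Section rV.
Context {R : realType} {n : nat}.
Implicit Types v : 'rV[R]_n.

Lemma coord_le_norm v i : `|v 0 i| <= `|v|.
Proof.
rewrite [leRHS]/Num.Def.normr/= mx_normrE.
exact: (@le_bigmax _ _ _ 0 (fun ij : 'I_1 * 'I_n => `|v ij.1 ij.2|) (0, i)).
Qed.

Lemma norm_le_coord v e : 0 <= e -> (forall i, `|v 0 i| <= e) -> `|v| <= e.
Proof.
move=> e0 ve; rewrite [leLHS]/Num.Def.normr/= mx_normrE.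
by apply: bigmax_le => // -[i j] _ /=; rewrite ord1.
Qed.

Lemma cvg_rV (T : Type) (G : set_system T) {FG : Filter G}
    (h : T -> 'rV[R]_n) v :
  (forall i, h x 0 i @[x --> G] --> v 0 i) -> h x @[x --> G] --> v.
Proof.
move=> hv; apply/cvgrPdist_le => e e0.
have : \forall x \near G, forall i, `|v 0 i - h x 0 i| <= e.
  by apply: filter_forall => i; exact: (cvgrPdist_le _ _).1 (hv i) _ e0.
apply: filterS => x hx; apply: norm_le_coord; first exact: ltW.
by move=> i; rewrite !mxE.
Qed.

Lemma continuous_rV (T : topologicalType) (h : T -> 'rV[R]_n) :
  (forall i, continuous (fun x => h x 0 i)) -> continuous h.
Proof. by move=> hc x; apply: cvg_rV => i; exact: hc. Qed.

Lemma is_derive_coord (x : R -> 'rV[R]_n) (t : R) v i :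
  is_derive t 1 x v -> is_derive t 1 (fun s => x s 0 i) (v 0 i).
Proof.
move=> [xd <-]; apply: DeriveDef.
  by move/derivable_mxP : xd; exact.
by rewrite derive_mx// mxE.
Qed.

Lemma is_derive_rV (x : R -> 'rV[R]_n) (t : R) v :
  (forall i, is_derive t 1 (fun s => x s 0 i) (v 0 i)) -> is_derive t 1 x v.
Proof.
move=> xd.
have dx : derivable x t 1.
  by apply/derivable_mxP => i j; rewrite ord1; case: (xd j).
apply: DeriveDef => //; rewrite derive_mx//; apply/rowP => i.
by rewrite mxE; case: (xd i).
Qed.

End rV.

(** * Solutions of a differential equation *)

Section solutions.
Context {R : realType} {n : nat}.
Implicit Types (f g : 'rV[R]_n -> 'rV[R]_n) (x y : R -> 'rV[R]_n) (b : \bar R).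

Lemma time_domain_gt0 b (t : R) : 0 < t -> (t%:E < b)%E ->
  \forall s \near t, 0 < s /\ (s%:E < b)%E.
Proof.
move=> t0 tb; near=> s; split; first by near: s; exact: lt_nbhsr.
near: s; case: b tb => [b| |] //=.
- rewrite lte_fin => tb; near=> s; rewrite lte_fin; near: s; exact: lt_nbhsl.
- by move=> _; apply: nearW => s; rewrite ltry.
Unshelve. all: by end_near. Qed.

Lemma solution_of_right_cont f b x : (0 < b)%E ->
  x t @[t --> 0^'+] --> x 0 ->
  (forall t : R, 0 < t -> (t%:E < b)%E -> is_derive t 1 x (f (x t))) ->
  solution f b x.
Proof.
move=> b0 x0 xd; split; [exact: b0| |exact: xd].
apply/subspace_continuousP => t [t0 tb].
move: t0; rewrite le_eqVlt => /predU1P[t0|t0].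
  rewrite -t0; apply: cvg_trans (cvg_at_right_within x0); apply: cvg_app => A.
  move=> HA; have {HA} : \forall u \near (0 : R), 0 <= u -> A u := HA.
  move=> HA; change (\forall u \near (0 : R), time_domain b u -> A u).
  by apply: filterS HA => u Au [u0 _]; exact: Au.
have := xd _ t0 tb => -[dx _].
have xc : {for t, continuous x}.
  exact/differentiable_continuous/derivable1_diffP.
exact: cvg_within_filter.
Qed.

Lemma solution_continuous f b x (s t : R) : solution f b x ->
  0 <= s -> (t%:E < b)%E -> {within `[s, t], continuous x}.
Proof.
move=> [_ + _] s0 tb; apply: continuous_subspaceW => u /=.
rewrite in_itv/= => /andP[su ut]; split; first exact: le_trans su.
by apply: le_lt_trans tb; rewrite lee_fin.
Qed.

Lemma solution_right_cont f b x : solution f b x -> x t @[t --> 0^'+] --> x 0.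
Proof.
move=> sx; have [b0 _ _] := sx.
have [c c0 cb] : exists2 c : R, 0 < c & (c%:E < b)%E.
  case: b b0 {sx} => [b| |]//= b0; last by exists 1 => //; rewrite ltry.
  rewrite lte_fin in b0; exists (b / 2); first by rewrite divr_gt0.
  by rewrite lte_fin ltr_pdivrMr// ltr_pMr// ltr1n.
by have /(continuous_within_itvP _ c0)[] := solution_continuous sx (lexx 0) cb.
Qed.

(** The mean value theorem, applied to each coordinate, replaces the integral
    form of the equation. *)
Lemma solution_mean_value f b x (s t : R) (c : 'rV[R]_n) e : solution f b x ->
  0 <= s -> s <= t -> (t%:E < b)%E ->
  (forall u, s < u < t -> `|f (x u) - c| <= e) ->
  `|x t - x s - (t - s) *: c| <= e * (t - s).
Proof.
move=> sx s0; rewrite le_eqVlt => /predU1P[<-|st] tb fe.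
  by rewrite !subrr scale0r subrr normr0 mulr0.
have e0 : 0 <= e.
  apply: le_trans (fe ((s + t) / 2) _); first exact: normr_ge0.
  by apply/andP; split; lra.
apply: norm_le_coord => [|i]; first by rewrite mulr_ge0// subr_ge0 ltW.
have [_ _ xd] := sx.
have [| |u] := @MVT R (fun u => x u 0 i) (fun u => f (x u) 0 i) s t st.
- move=> u; rewrite in_itv/= => /andP[su ut]; apply: is_derive_coord.
  by apply: xd; [exact: le_lt_trans su|apply: lt_trans tb; rewrite lte_fin].
- have /subspace_continuousP xc := solution_continuous sx s0 tb.
  apply/subspace_continuousP => u ust.
  apply: (@cvg_comp _ _ _ x (fun v : 'rV[R]_n => v 0 i) _ (nbhs (x u))).
    exact: xc.
  exact: coord_continuous.
- rewrite in_itv/= => ust xE.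
  rewrite !mxE xE (mulrC (t - s)) -mulrBl normrM.
  rewrite (ger0_norm (_ : 0 <= t - s)); last by rewrite subr_ge0 ltW.
  rewrite ler_wpM2r//; first by rewrite subr_ge0 ltW.
  have := coord_le_norm (f (x u) - c) i; rewrite !mxE => /le_trans; apply.
  exact: fe.
Qed.

(** A limit of solutions satisfies inequalities between increments, which carry
    no derivative; this is how the derivative is recovered from them. *)
Lemma is_derive_expansion x (t : R) v :
  (forall e, 0 < e -> \forall s \near t,
    `|x s - x t - (s - t) *: v| <= e * `|s - t|) ->
  is_derive t 1 x v.
Proof.
move=> xv.
have cv : h^-1 *: (x (h *: 1 + t) - x t) @[h --> 0^'] --> v.
  apply/cvgrPdist_le => e e0.
  have := xv _ e0 => /nbhs_ballP[d d0 hd].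
  near=> h.
  have h0 : h != 0 by near: h; exact: nbhs_dnbhs_neq.
  have hE : h *: 1 = h :> R by rewrite /GRing.scale/= mulr1.
  rewrite hE.
  have : `|x (h + t) - x t - h *: v| <= e * `|h|.
    have := hd (h + t); rewrite addrK; apply.
    rewrite /ball/= opprD addrCA subrr addr0 normrN.
    by near: h; exact: dnbhs0_lt.
  have -> : x (h + t) - x t - h *: v = h *: (h^-1 *: (x (h + t) - x t) - v).
    by rewrite scalerBr scalerA mulfV// scale1r.
  by rewrite normrZ mulrC ler_pM2r ?normr_gt0// distrC.
apply: DeriveDef; first by apply/cvg_ex; exists v.
exact/cvg_lim.
Unshelve. all: by end_near. Qed.

End solutions.

(** * Extension to maximal solutions *)

Section extension.
Context {R : realType} {n : nat}.
Implicit Types (f g : 'rV[R]_n -> 'rV[R]_n) (x y : R -> 'rV[R]_n) (b : \bar R).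

(** Being a solution is a local property, so a union of compatible solutions is
    again one. *)
Lemma solution_local f b x : (0 < b)%E ->
  (forall t : R, time_domain b t -> exists b' y,
    [/\ solution f b' y, (t%:E < b')%E &
        forall s, time_domain b' s -> x s = y s]) ->
  solution f b x.
Proof.
move=> b0 loc; apply: solution_of_right_cont => //.
- have [|b' [y [sy b'0 xy]]] := loc 0; first by split.
  have ltb' : ((0 : R)^'+) [set t : R | (t%:E < b')%E].
    move: b'0; case: (b') => [c| |]//=.
      by rewrite lte_fin => /nbhs_right_lt; apply: filterS => s; rewrite /= lte_fin.
    by move=> _; apply: filterE => s /=; rewrite ltry.
  have yx0 : ((0 : R)^'+) [set t | y t = x t].
    apply: filterS2 (nbhs_right_gt 0) ltb' => t t0 tb' /=.
    by rewrite xy//; split => //; exact: ltW.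
  by rewrite xy//; apply: cvg_trans (solution_right_cont sy); exact: near_eq_cvg yx0.
- move=> t t0 tb; have [|b' [y [sy b't xy]]] := loc t; first by split=> //; exact: ltW.
  rewrite xy; last by split => //; exact: ltW.
  have [_ _ yd] := sy; apply: near_eq_is_derive (yd t t0 b't).
  apply: filterS (time_domain_gt0 t0 b't) => s [s0 sb].
  by rewrite xy//; split => //; exact: ltW.
Unshelve. all: by end_near. Qed.

Let extends (p q : \bar R * (R -> 'rV[R]_n)) :=
  (p.1 <= q.1)%E /\ forall t, time_domain p.1 t -> p.2 t = q.2 t.

Let extends_trans p q r : extends p q -> extends q r -> extends p r.
Proof.
move=> [pq pqE] [qr qrE]; split; first exact: le_trans qr.
move=> t [t0 tp]; rewrite pqE//; apply: qrE; split => //.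
exact: lt_le_trans pq.
Qed.

(** The bound of a chain is the union of its members. As the functions are
    total, [xget] selects at each time a member defined there; on a chain the
    value does not depend on the selection. *)
Lemma solution_chain_bound f (C : set (\bar R * (R -> 'rV[R]_n))) p0 :
  C p0 -> (forall p, C p -> solution f p.1 p.2) -> total_on C extends ->
  exists2 q, solution f q.1 q.2 & forall p, C p -> extends p q.
Proof.
move=> Cp0 Csol Ctot.
pose bsup := ereal_sup [set p.1 | p in C].
pose pick t := xget p0 [set p | C p /\ time_domain p.1 t].
pose u t := (pick t).2 t.
have uE p t : C p -> time_domain p.1 t -> u t = p.2 t.
  move=> Cp pt.
  have [Cq qt] : [set p | C p /\ time_domain p.1 t] (pick t).
    by apply: (@xgetPex _ p0); exists p.
  by rewrite /u; case: (Ctot _ _ Cq Cp) => -[_ ->].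
have Cle p : C p -> (p.1 <= bsup)%E.
  by move=> Cp; apply: ereal_sup_ubound; exists p.
exists (bsup, u) => /=; last first.
  by move=> p Cp; split; [exact: Cle|move=> t pt; exact/esym/uE].
apply: solution_local => /=.
  by have [p00 _ _] := Csol _ Cp0; apply: lt_le_trans (Cle _ Cp0).
move=> t [t0 /ereal_sup_gt[_ [p Cp <-] tp]].
exists p.1, p.2; split => [||s]; [exact: Csol|exact: tp|exact: (uE p)].
Qed.

(** [extends] is only a preorder, since it ignores values outside the time
    domains, but a premaximal element is maximal in the sense of
    [maximal_solution]. *)
Lemma solution_extends_maximal f b x : solution f b x ->
  exists b' y, [/\ maximal_solution f b' y, (b <= b')%E &
    forall t, time_domain b t -> x t = y t].
Proof.
move=> sx.
pose T := {p : \bar R * (R -> 'rV[R]_n) | solution f p.1 p.2 /\ extends (b, x) p}.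
have xx : extends (b, x) (b, x) by split.
pose t0 : T := exist _ (b, x) (conj sx xx).
pose r (p q : T) := `[< extends (sval p) (sval q) >].
have [|p q s /asboolP pq /asboolP qs||[[b' y] [/= sy [bb' xy]]] ymax] :=
    @ZL_preorder T t0 r.
- by move=> p; apply/asboolP; split.
- by apply/asboolP; exact: extends_trans qs.
- move=> A Atot; have [->|/set0P[p0 Ap0]] := eqVneq A set0; first by exists t0.
  have [|||q sq Aq] := @solution_chain_bound f [set sval p | p in A] (sval p0).
  + by exists p0.
  + by move=> _ [p Ap <-]; have [] := svalP p.
  + move=> _ _ [p Ap <-] [q Aq <-].
    by case: (Atot _ _ Ap Aq) => /asboolP ?; [left|right].
  + have xq : extends (b, x) q.
      apply: (@extends_trans _ (sval p0)); first by have [] := svalP p0.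
      by apply: Aq; exists p0.
    exists (exist _ q (conj sq xq)) => p Ap; apply/asboolP => /=.
    by apply: Aq; exists p.
- exists b', y; split => //; split => // b'' z sz b'b'' yz.
  have yz' : extends (b', y) (b'', z) by [].
  have xz : extends (b, x) (b'', z) := extends_trans (conj bb' xy) yz'.
  have /asboolP [/= b''b' _] : r (exist _ (b'', z) (conj sz xz))
      (exist _ (b', y) (conj sy (conj bb' xy))).
    by apply: ymax; apply/asboolP.
  by apply/eqP; rewrite eq_le b'b'' b''b'.
Qed.

(** This is how attractivity is used: it speaks of maximal solutions only, and
    through the extension it excludes finite-time blow-up of any solution. *)
Lemma attractive_extension f b x : globally_attractive_origin f ->
  solution f b x -> exists y, [/\ solution f +oo%E y,
    forall t, time_domain b t -> x t = y t & y t @[t --> +oo] --> (0 : 'rV[R]_n)].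
Proof.
move=> fa /solution_extends_maximal[b' [y [my _ xy]]].
by have [b'oo y0] := fa _ _ my; exists y; split => //; rewrite -b'oo; case: my.
Qed.

End extension.

(** * Change of time and of coordinates, escape from a ball *)

Section reparametrization.
Context {R : realType} {n : nat}.
Implicit Types (f g : 'rV[R]_n -> 'rV[R]_n) (x y : R -> 'rV[R]_n) (b : \bar R).

Lemma is_derive_affine x (a c t : R) v : is_derive (a + c * t) 1 x v ->
  is_derive t 1 (fun s => x (a + c * s)) (c *: v).
Proof.
move=> dx; apply: is_derive_rV => i; rewrite mxE mulrC.
have := is_derive_coord i dx => dxi.
have da : is_derive t 1 (fun s => a + c * s) c.
  have := is_deriveD (is_derive_cst a t 1) (is_deriveZ c (is_derive_id t 1)).
  by rewrite add0r /GRing.scale/= mulr1; exact.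
exact: (@is_derive1_comp R (fun u => x u 0 i) (fun s => a + c * s)
  t _ _ dxi da).
Qed.

Lemma solution_affine_time f x (a c : R) : 0 <= a -> 0 < c ->
  solution f +oo%E x ->
  solution (fun v => c *: f v) +oo%E (fun s => x (a + c * s)).
Proof.
move=> a0 c0 sx; have [_ _ xd] := sx.
apply: solution_of_right_cont => [|| t t0 _]; first by rewrite ltry.
- rewrite mulr0 addr0; apply/cvgrPdist_lt => e e0.
  have a1 : a < a + 1 by rewrite ltrDl.
  have /(continuous_within_itvP _ a1)[_ + _] :=
    solution_continuous sx a0 (ltry (a + 1)).
  move=> /cvgrPdist_lt/(_ _ e0)/nbhs_ballP[d d0 hd].
  apply/nbhs_ballP; exists (d / c) => [|s]; first by rewrite /= divr_gt0.
  rewrite /ball/= sub0r normrN => sd s0.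
  apply: hd; last by rewrite ltrDl mulr_gt0.
  rewrite /ball/= opprD addrA subrr sub0r normrN normrM (gtr0_norm c0) mulrC.
  by rewrite -ltr_pdivlMr.
- by apply: is_derive_affine; apply: xd; [rewrite ltr_wpDl// mulr_gt0|rewrite ltry].
Qed.

Lemma solution_shift f x (a : R) : 0 <= a -> solution f +oo%E x ->
  solution f +oo%E (fun s => x (a + s)).
Proof.
move=> a0 /(solution_affine_time a0 ltr01).
under eq_fun do rewrite scale1r.
by under [X in solution _ _ X]eq_fun do rewrite mul1r.
Qed.

Lemma dilation_continuous (l : R) (r : 'rV[R]_n) : continuous (dilation l r).
Proof.
apply: continuous_rV => i v.
under eq_fun do rewrite mxE.
by apply: (@cvgMl_tmp _ _ (nbhs v) _ (fun w : 'rV_n => w 0 i)); exact: coord_continuous.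
Qed.

Lemma solution_dilation f g b x (l : R) (r : 'rV[R]_n) : solution f b x ->
  (forall v, g (dilation l r v) = dilation l r (f v)) ->
  solution g b (fun s => dilation l r (x s)).
Proof.
move=> sx gf; have [b0 _ xd] := sx; apply: solution_of_right_cont => // [|t t0 tb].
  exact: cvg_comp (solution_right_cont sx) (@dilation_continuous l r (x 0)).
rewrite gf; apply: is_derive_rV => i; rewrite mxE.
under eq_fun do rewrite mxE.
have := is_derive_coord i (xd t t0 tb) => dxi.
by apply: (@is_deriveZ _ _ _ _ (l `^ r 0 i)).
Qed.

(** A speed bound valid only inside the ball of radius [M + 1] suffices: at the
    first time [s] when the norm reaches [M + 1], the distance covered is at most
    [L * (s - t0) < 1], which is not enough to come from the ball of radius [M]. *)
Lemma solution_escape f x (t0 t1 M L : R) : solution f +oo%E x ->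
  0 <= t0 -> t0 <= t1 -> `|x t0| <= M -> L * (t1 - t0) < 1 ->
  (forall u, t0 <= u <= t1 -> `|x u| <= M + 1 -> `|f (x u)| <= L) ->
  `|x t1| <= M + 1.
Proof.
move=> sx t00 t01 xM Lt fL; rewrite leNgt; apply/negP => xt1.
pose E := [set s | t0 <= s <= t1 /\ M + 1 <= `|x s|].
have Et1 : E t1 by split; [rewrite t01 lexx|exact: ltW].
have Einf : has_inf E.
  by split; [exists t1|exists t0 => s [/andP[]]].
pose s := inf E.
have t0s : t0 <= s by apply: lb_le_inf; [exists t1|move=> u [/andP[]]].
have st1 : s <= t1 by apply: ge_inf => //; exact: Einf.2.
have xs : `|x s| < M + 1.
  have : `|x s - x t0 - (s - t0) *: 0| <= L * (s - t0).
    apply: (solution_mean_value sx) => //; first by rewrite ltry.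
    move=> u /andP[t0u us]; rewrite subr0.
    have ut1 : t0 <= u <= t1 by rewrite (ltW t0u) (le_trans (ltW us)).
    apply: fL => //; rewrite leNgt; apply/negP => xu.
    have : E u by split => //; exact: ltW.
    by move=> /(ge_inf Einf.2); rewrite leNgt us.
  rewrite scaler0 subr0 => xst0.
  have L0 : 0 <= L by apply: le_trans (fL t0 _ _); rewrite ?lexx ?t01//; lra.
  have : L * (s - t0) <= L * (t1 - t0) by rewrite ler_wpM2l// lerB.
  have := ler_normD (x s - x t0) (x t0); rewrite subrK; lra.
have /subspace_continuousP/(_ s) := solution_continuous sx t00 (ltry t1).
rewrite /= in_itv/= t0s st1 => /(_ isT)/cvgrPdist_lt/(_ (M + 1 - `|x s|)).
rewrite subr_gt0 => /(_ xs)/nbhs_ballP[d d0 hd].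
have [u Eu us] := inf_adherent d0 Einf.
have su := ge_inf Einf.2 Eu.
case: Eu => ut01 xu.
have := hd u; rewrite /ball/= in_itv/= ut01 => /(_ _ isT).
rewrite distrC ger0_norm ?subr_ge0// ltrBlDl => /(_ us).
rewrite distrC; have := ler_normD (x u - x s) (x s); rewrite subrK; lra.
Qed.

Lemma solution_mean_value_sym f x (s t T : R) (c : 'rV[R]_n) e :
  solution f +oo%E x -> 0 <= s <= T -> 0 <= t <= T ->
  (forall u, 0 <= u <= T -> `|u - s| <= `|t - s| -> `|f (x u) - c| <= e) ->
  `|x t - x s - (t - s) *: c| <= e * `|t - s|.
Proof.
move=> sx /andP[s0 sT] /andP[t0 tT] fe; have [st|ts] := leP s t.
  rewrite (ger0_norm (_ : 0 <= t - s)) ?subr_ge0//.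
  apply: (solution_mean_value sx) => //; first by rewrite ltry.
  move=> u /andP[su ut]; apply: fe; first by apply/andP; split; lra.
  by rewrite !ger0_norm ?subr_ge0// ?lerB//; exact: ltW.
rewrite -[leLHS]normrN.
have -> : - (x t - x s - (t - s) *: c) = x s - x t - (s - t) *: c.
  by rewrite opprB opprB addrC -[in RHS](opprB t s) scaleNr opprK.
rewrite (distrC t s) (ger0_norm (_ : 0 <= s - t)) ?subr_ge0//; last exact: ltW.
apply: (solution_mean_value sx) => //; [exact: ltW|by rewrite ltry|].
move=> u /andP[tu us]; apply: fe; first by apply/andP; split; lra.
by rewrite distrC [leRHS]distrC !ger0_norm ?subr_ge0// ?lerB//; exact: ltW.
Qed.

Lemma compact_norm_le (M : R) : compact [set v : 'rV[R]_n | `|v| <= M].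
Proof.
apply: bounded_closed_compact.
  exists M; split; first exact: num_real.
  by move=> M' MM' v /= /le_trans; apply; exact: ltW.
rewrite (_ : mkset _ = (fun v : 'rV[R]_n => `|v|) @^-1` [set a : R | a <= M])//.
by apply: closed_comp; [move=> v _; exact: norm_continuous|exact: closed_le].
Qed.

Lemma ultra_cvg_bounded (U : set_system nat) (h : nat -> 'rV[R]_n) M :
  UltraFilter U -> (\forall k \near U, `|h k| <= M) ->
  exists v : 'rV[R]_n, h k @[k --> U] --> v.
Proof.
move=> UU hM; have [v [_ clv]] := @compact_norm_le M (h @ U) _ hM.
exists v => V /= vV; have [//|nV] := in_ultra_setVsetC (h @^-1` V) UU.
by have [w []] := clv (~` V) V nV vV.
Qed.

End reparametrization.

(** * A limit of solutions that avoid the origin *)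

Section avoiding_sequence.
Context {R : realType} {n : nat}.
Variables (F : 'rV[R]_n -> 'rV[R]_n) (A : set 'rV[R]_n).
Variables (g : nat -> 'rV[R]_n -> 'rV[R]_n) (y : nat -> R -> 'rV[R]_n) (M0 : R).
Hypotheses (Fc : continuous F) (Acl : closed A) (A0 : ~ A 0).
Hypothesis gF : forall C : set 'rV[R]_n, compact C -> ~ C 0 ->
  forall e, 0 < e -> \forall k \near \oo, forall v, C v -> `|g k v - F v| <= e.
Hypothesis ysol : forall k, solution (g k) +oo%E (y k).
Hypothesis y0M : forall k, `|y k 0| <= M0.
Hypothesis yA : forall T,
  \forall k \near \oo, forall t, 0 <= t <= T -> A (y k t).

Let K M := A `&` [set v | `|v| <= M].

Let K_compact M : compact (K M).
Proof. by rewrite /K setIC; apply: compact_closedI => //; exact: compact_norm_le. Qed.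

Let K0 M : ~ K M 0. Proof. by case. Qed.

(** [F] is bounded on the compact set [K M], and [g k] is close to [F] there. *)
Lemma eventual_speed_bound M : exists2 L, 0 < L &
  \forall k \near \oo, forall v, A v -> `|v| <= M -> `|g k v| <= L.
Proof.
have : bounded_set (F @` K M).
  apply: compact_bounded; apply: continuous_compact; last exact: K_compact.
  exact: continuous_subspaceT.
move=> [L0 [_ hL]]; pose L1 := `|L0| + 1.
have FL v : K M v -> `|F v| <= L1.
  move=> Kv; apply: (hL L1); last by exists v.
  by rewrite /L1 (le_lt_trans (ler_norm _))// ltrDl.
exists (L1 + 1); first by rewrite /L1 -addrA ltr_wpDl.
have := gF (@K_compact M) (@K0 M) ltr01.
apply: filterS => k hk v Av vM.
have := hk v (conj Av vM); have := FL v (conj Av vM).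
by have := ler_normD (g k v - F v) (F v); rewrite subrK; lra.
Qed.

Variable U : set_system nat.
Hypothesis UU : UltraFilter U.
Hypothesis Uoo : \oo `<=` U.

Let bounded_on M t : set nat := [set k | forall s, 0 <= s <= t -> `|y k s| <= M].
Let bounded_until (t : R) : Prop := exists M : R, U (bounded_on M t).

(** The step [d] depends only on the bound [M] at the time [t], not on the bound
    over [[0, t]]; this uniformity excludes a finite supremum of the times up to
    which the sequence is bounded. *)
Lemma bounded_until_propagates M : exists2 d, 0 < d & forall t, 0 <= t ->
  bounded_until t -> U [set k | `|y k t| <= M] -> bounded_until (t + d).
Proof.
have [L L0 hL] := eventual_speed_bound (M + 1).
(* covering a distance 1 at speed L takes longer than d *)
pose d := (2 * L)^-1; have d0 : 0 < d by rewrite invr_gt0 mulr_gt0.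
have Ld : L * d < 1.
  by rewrite /d invfM mulrCA mulfV ?gt_eqF// mulr1 invf_lt1// ltr1n.
exists d => // t t0 [N UN] UM; exists (Num.max N (M + 1)).
apply: filterS (filterI (filterI UN UM) (filterI (Uoo hL) (Uoo (yA (t + d))))).
move=> k [[kN kM] [kL kA]] s /andP[s0 std]; rewrite le_max.
have [st|ts] := leP s t; first by rewrite kN// s0.
apply/orP; right.
apply: (solution_escape (ysol k) t0 (ltW ts) kM (L := L)).
- by apply: le_lt_trans Ld; rewrite ler_pM2l// lerBlDl.
- move=> u /andP[tu us] uM; apply: kL => //; apply: kA.
  by rewrite (le_trans t0 tu) (le_trans us).
Qed.

(** Along an ultrafilter every bounded sequence converges, so the limit exists at
    all times at once and no diagonal extraction of subsequences is needed. *)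
Let z (t : R) : 'rV[R]_n := get [set v | y k t @[k --> U] --> v].

Let bounded_untilW s t : s <= t -> bounded_until t -> bounded_until s.
Proof.
move=> st [M UM]; exists M; apply: filterS UM => k kM u /andP[u0 us].
by apply: kM; rewrite u0 (le_trans us).
Qed.

Let z_cvg t : 0 <= t -> bounded_until t -> y k t @[k --> U] --> z t.
Proof.
move=> t0 [M UM]; have [v vE] : exists v : 'rV[R]_n, y k t @[k --> U] --> v.
  apply: (@ultra_cvg_bounded _ _ _ _ M UU).
  by apply: filterS UM => k; apply; rewrite t0 lexx.
exact: (@getPex _ [set v | y k t @[k --> U] --> v]) (ex_intro _ v vE).
Qed.

Let z_A t : 0 <= t -> bounded_until t -> A (z t).
Proof.
move=> t0 bt; apply: (@closed_cvg _ _ U _ (fun k => y k t) A Acl) (z_cvg t0 bt).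
by apply: filterS (Uoo (yA t)) => k; apply; rewrite t0 lexx.
Qed.

(** Near the time [t] all [y k u] are close to [z t]: they are at time [t], by
    convergence, and the common speed bound [L] keeps them so. Hence the mean
    value inequality for [y k] holds with a slope close to [F (z t)], and passes
    to the limit. *)
Lemma limit_expansion t1 t e : 0 <= t <= t1 -> bounded_until t1 -> 0 < e ->
  exists2 d, 0 < d & forall s, 0 <= s <= t1 -> `|s - t| < d ->
    `|z s - z t - (s - t) *: F (z t)| <= e * `|s - t|.
Proof.
move=> /andP[t0 tt1] bt1 e0; have [M UM] := bt1.
have [L L0 hL] := eventual_speed_bound M.
have e20 : 0 < e / 2 by rewrite divr_gt0.
have /cvgrPdist_le/(_ _ e20)/nbhs_ballP[d d0 hd] := @Fc (z t).
exists (d / 2 / L) => [|s /andP[s0 st1] sd]; first by rewrite !divr_gt0.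
have zt := z_cvg t0 (bounded_untilW tt1 bt1).
have zs := z_cvg s0 (bounded_untilW st1 bt1).
have d20 : 0 < d / 2 by rewrite divr_gt0.
have cv : y k s - y k t - (s - t) *: F (z t) @[k --> U] -->
    z s - z t - (s - t) *: F (z t).
  by apply: cvgB; [exact: cvgB|exact: cvg_cst].
have clN : closed [set v : 'rV[R]_n | `|v| <= e * `|s - t|].
  by apply: compact_closed; [exact: norm_hausdorff|exact: compact_norm_le].
apply: (@closed_cvg _ _ U _ _ _ clN) cv.
have Ud : U [set k | `|z t - y k t| < d / 2].
  exact: (cvgrPdist_lt _ _).1 zt _ d20.
have Ug := Uoo (gF (@K_compact M) (@K0 M) e20).
apply: filterS3 Ug UM (filterI (Uoo hL) (filterI (Uoo (yA t1)) Ud)).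
move=> k kg kM [kL [kA /= kd]] /=.
have kK u : 0 <= u <= t1 -> K M (y k u).
  by move=> ut1; split; [exact: kA|exact: kM].
have tt : 0 <= t <= t1 by rewrite t0.
have ss : 0 <= s <= t1 by rewrite s0.
apply: (solution_mean_value_sym (ysol k) tt ss) => u ut1 us.
have ytu : `|y k u - y k t| < d / 2.
  have : `|y k u - y k t - (u - t) *: 0| <= L * `|u - t|.
    apply: (solution_mean_value_sym (ysol k) tt ut1) => w wt1 _.
    by rewrite subr0; have [? ?] := kK w wt1; exact: kL.
  rewrite scaler0 subr0 => /le_lt_trans; apply.
  rewrite mulrC -ltr_pdivlMr//; exact: le_lt_trans sd.
have /hd /= : ball (z t) d (y k u).
  rewrite -ball_normE /ball_/=; have := ler_normD (z t - y k t) (y k t - y k u).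
  by rewrite addrA subrK (distrC (y k t)); lra.
have := kg _ (kK u ut1).
have := ler_normD (g k (y k u) - F (y k u)) (F (y k u) - F (z t)).
by rewrite addrA subrK (distrC (F (z t))); lra.
Qed.

(** The life time of the limit [z]. *)
Let bsup : \bar R :=
  ereal_sup [set t%:E | t in [set t | 0 <= t /\ bounded_until t]].

Let bounded_until_lt_bsup (t : R) : (t%:E < bsup)%E ->
  exists2 t1, t < t1 & bounded_until t1.
Proof.
move=> /ereal_sup_gt[_ [t1 [_ bt1] <-]]; rewrite lte_fin => tt1.
by exists t1.
Qed.

Let bounded_until_le_bsup (t : R) : 0 <= t -> bounded_until t ->
  (t%:E <= bsup)%E.
Proof. by move=> t0 bt; apply: ereal_sup_ubound; exists t. Qed.

Let bsup_gt0 : (0 < bsup)%E.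
Proof.
have [d d0 /(_ 0 (lexx 0))] := bounded_until_propagates M0.
have bounded_until0 : bounded_until 0.
  by exists M0; apply: filterE => k s; rewrite -eq_le => /eqP <-.
rewrite add0r => /(_ bounded_until0 (filterE _ y0M)) bd.
apply: (@lt_le_trans _ _ d%:E); first by rewrite lte_fin.
exact: bounded_until_le_bsup (ltW d0) _.
Qed.

Lemma limit_solution : solution F bsup z.
Proof.
apply: solution_of_right_cont => // [|t t0 /bounded_until_lt_bsup[t1 tt1 bt1]].
- have [t1 t10 bt1] := bounded_until_lt_bsup bsup_gt0.
  have t01 : (0 : R) <= 0 <= t1 by apply/andP; split; [exact: lexx|exact: ltW].
  have [d d0 hd] := limit_expansion t01 bt1 ltr01.
  apply/cvgrPdist_lt => e e0.
  have c0 : 0 < 1 + `|F (z 0)| by rewrite ltr_pwDl.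
  near=> s.
  have s0 : 0 < s by near: s; exact: nbhs_right_gt.
  have := hd s; rewrite subr0 (gtr0_norm s0) => /(_ _ _)/le_lt_trans h.
  have : `|z s - z 0 - s *: F (z 0)| <= s.
    rewrite -[leRHS]mul1r; have := hd s; rewrite subr0 (gtr0_norm s0); apply.
      by rewrite (ltW s0)/= ltW//; near: s; exact: nbhs_right_lt.
    by near: s; exact: nbhs_right_lt.
  have := ler_normD (z s - z 0 - s *: F (z 0)) (s *: F (z 0)).
  rewrite subrK normrZ (gtr0_norm s0) distrC.
  have : s * (1 + `|F (z 0)|) < e.
    rewrite -ltr_pdivlMr//; near: s; apply: nbhs_right_lt; exact: divr_gt0.
  by rewrite mulrDr mulr1; lra.
- apply: is_derive_expansion => e e0.
  have t01 : 0 <= t <= t1 by rewrite !ltW.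
  have [d d0 hd] := limit_expansion t01 bt1 e0.
  near=> s; apply: hd.
    by apply/andP; split; near: s; [exact: lt_le_nbhsr|exact: lt_le_nbhsl].
  by rewrite distrC; near: s; exact: (nbhsx_ballx t d d0).
Unshelve. all: by end_near. Qed.

Hypothesis Fattr : globally_attractive_origin F.

(** If [bsup] is infinite, [z] stays in the closed set [A] and tends to 0. If it
    is finite, [z] is bounded before [bsup], because it extends to a global
    solution, and propagating boundedness from a time close enough to [bsup]
    goes beyond [bsup]. *)
Lemma no_avoiding_sequence : False.
Proof.
have [w [sw zw w0]] := attractive_extension Fattr limit_solution.
have [bfin|bnfin] := eqVneq bsup +oo%E.
  suff : A 0 by [].
  apply: (@closed_cvg _ _ (pinfty_nbhs R) _ w A Acl) w0.
  exists 0; split; first exact: num_real.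
  move=> t t0.
  have /bounded_until_lt_bsup[t1 tt1 bt1] : (t%:E < bsup)%E by rewrite bfin ltry.
  rewrite -zw; last by split; [exact: ltW|rewrite bfin ltry].
  by apply: z_A (ltW t0) _; apply: bounded_untilW bt1; exact: ltW.
have [b bE] : exists b, bsup = b%:E.
  by move: bnfin bsup_gt0; case: bsup => // b _ _; exists b.
have b0 : 0 < b by have := bsup_gt0; rewrite bE lte_fin.
have [B hB] : exists B, forall t, 0 <= t <= b -> `|w t| <= B.
  have wc := solution_continuous sw (lexx 0) (ltry b).
  have : bounded_set (w @` `[0, b]).
    apply: compact_bounded; apply: (continuous_compact wc).
    exact: segment_compact.
  move=> [B0 [_ hB]]; exists (`|B0| + 1) => t tb; apply: hB.
    by rewrite (le_lt_trans (ler_norm _))// ltrDl.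
  by exists t => //=; rewrite in_itv.
have [d d0 hd] := bounded_until_propagates (B + 1).
(* less than d before the supposed blow-up time *)
pose t := Num.max 0 (b - d / 2).
have t0 : 0 <= t by rewrite le_max lexx.
have tb : t < b by rewrite gt_max b0/=; lra.
have tbd : b < t + d by rewrite -ltrBlDr lt_max; apply/orP; right; lra.
have [t1 tt1 bt1] : exists2 t1, t < t1 & bounded_until t1.
  by apply: bounded_until_lt_bsup; rewrite bE lte_fin.
have bt := bounded_untilW (ltW tt1) bt1.
have : bounded_until (t + d).
  have zt : U [set k | `|z t - y k t| <= 1].
    exact: (cvgrPdist_le _ _).1 (z_cvg t0 bt) _ ltr01.
  apply: (hd t t0 bt); apply: filterS zt => k /=.
  have := hB t; rewrite t0 (ltW tb) -zw; last by split; rewrite // bE lte_fin.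
  move=> /(_ isT); have := ler_normD (y k t - z t) (z t).
  by rewrite subrK distrC; lra.
have td0 : 0 <= t + d by rewrite addr_ge0// ltW.
by move=> /(bounded_until_le_bsup td0); rewrite bE lee_fin leNgt tbd.
Qed.

End avoiding_sequence.

(** * Uniform attraction and contraction of homogeneous boxes *)

Section reach.
Context {R : realType} {n : nat}.
Implicit Types (f g F : 'rV[R]_n -> 'rV[R]_n) (x y : R -> 'rV[R]_n).

(** A set [D k] of fields, instead of a single one, lets the scale of the rescaled
    field vary while [k] measures its closeness to the limit. If no [k] worked
    with [T = k + 1], choosing a bad solution for each [k] would give a sequence
    avoiding the origin. *)
Lemma uniform_reach F (A : set 'rV[R]_n) (D : nat -> set ('rV[R]_n -> 'rV[R]_n))
    (M : R) : continuous F -> globally_attractive_origin F -> closed A -> ~ A 0 ->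
  (forall C : set 'rV[R]_n, compact C -> ~ C 0 -> forall e, 0 < e ->
    \forall k \near \oo, forall g, D k g -> forall v, C v -> `|g v - F v| <= e) ->
  exists k (T : R), 0 < T /\ forall g y, D k g -> solution g +oo%E y ->
    `|y 0| <= M -> exists2 t, 0 <= t <= T & ~ A (y t).
Proof.
move=> Fc Fa Acl A0 DF; apply: contrapT => Dn.
have {Dn} bad k : exists gy : ('rV[R]_n -> 'rV[R]_n) * (R -> 'rV[R]_n),
    [/\ D k gy.1, solution gy.1 +oo%E gy.2, `|gy.2 0| <= M &
        forall t, 0 <= t <= k.+1%:R -> A (gy.2 t)].
  apply: contrapT => nk; apply: Dn; exists k, k.+1%:R.
  split=> [|g y Dg sy yM]; first by rewrite ltr0n.
  apply: contrapT => nt; apply: nk; exists (g, y); split => //.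
  by move=> t tk; apply: contrapT => nA; apply: nt; exists t.
have [gy gyP] := choice bad.
have [U [UU Uoo]] := ultraFilterLemma (@eventually_filter).
apply: (@no_avoiding_sequence _ _ F A (fun k => (gy k).1) (fun k => (gy k).2)
  M Fc Acl A0
  _ _ _ _ U UU Uoo Fa).
- move=> C Cc C0 e e0; apply: filterS (DF C Cc C0 e e0) => k h v Cv.
  by apply: h => //; have [] := gyP k.
- by move=> k; have [] := gyP k.
- by move=> k; have [] := gyP k.
- move=> T; apply: filterS (nbhs_infty_ger T) => k Tk t /andP[t0 tT].
  have [_ _ _] := gyP k; apply; rewrite t0 (le_trans tT)// (le_trans Tk)//.
  by rewrite ler_nat.
Qed.

Lemma closed_norm_ge (h : 'rV[R]_n -> 'rV[R]_n) (a : R) : continuous h ->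
  closed [set v | a <= `|h v|].
Proof.
move=> hc; rewrite (_ : mkset _ = (fun v => `|h v|) @^-1` [set b : R | a <= b])//.
apply: closed_comp; last exact: closed_ge.
by move=> v _; apply: (@cvg_norm _ _ _ (nbhs v)); exact: hc.
Qed.

Lemma dilationM (a b : R) (r v : 'rV[R]_n) : 0 <= a -> 0 <= b ->
  dilation a r (dilation b r v) = dilation (a * b) r v.
Proof. by move=> a0 b0; apply/rowP => i; rewrite !mxE powRM// mulrA. Qed.

Lemma dilation1 (r v : 'rV[R]_n) : dilation 1 r v = v.
Proof. by apply/rowP => i; rewrite !mxE powR1 mul1r. Qed.

Lemma dilation0 (a : R) (r : 'rV[R]_n) : dilation a r 0 = 0.
Proof. by apply/rowP => i; rewrite !mxE mulr0. Qed.

(** The field [f] seen at scale [l]; its limits as [l] tends to 0 or to infinity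
    are the approximating fields of the homogeneity assumptions. *)
Definition rescaled_field f (r : 'rV[R]_n) (d l : R) : 'rV[R]_n -> 'rV[R]_n :=
  fun v => \row_i (f (dilation l r v) 0 i / l `^ (d + r 0 i)).

Lemma solution_rescaled f x (r : 'rV[R]_n) (d l : R) : 0 < l ->
  solution f +oo%E x ->
  solution (rescaled_field f r d l) +oo%E
    (fun s => dilation l^-1 r (x (l `^ (- d) * s))).
Proof.
move=> l0 /(solution_affine_time (lexx 0) (powR_gt0 (- d) l0)).
under [X in solution _ _ X]eq_fun do rewrite add0r.
move=> /solution_dilation; apply => v.
apply/rowP => i; rewrite !mxE dilationM ?invr_ge0 ?ltW// mulfV ?gt_eqF// dilation1.
rewrite powRD; last by rewrite (gt_eqF l0)/= implybT.
rewrite invfM powRN (_ : l^-1 = l `^ (-1)); last first.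
  by rewrite powR_inv1// ltW.
rewrite -powRrM mulN1r powRN.
by rewrite [RHS]mulrA [RHS]mulrC [in RHS](mulrC (_^-1)).
Qed.

(** A ball of radius [l] for the homogeneous norm of weight [r]. This
    form makes the dilation by [l^-1] turn it into the unit ball. *)
Definition box (r : 'rV[R]_n) (l : R) : set 'rV[R]_n :=
  [set v | `|dilation l^-1 r v| <= 1].

Lemma boxP (r : 'rV[R]_n) (l : R) v : 0 < l ->
  box r l v <-> forall i, `|v 0 i| <= l `^ r 0 i.
Proof.
move=> l0.
have lE i : `|dilation l^-1 r v 0 i| <= 1 = (`|v 0 i| <= l `^ r 0 i).
  rewrite mxE normrM ger0_norm ?powR_ge0// -(powR_inv1 (ltW l0)) -powRrM mulN1r.
  by rewrite powRN ler_pdivrMl ?powR_gt0// mulr1.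
rewrite /box/=; split=> [h i|h]; first by rewrite -lE (le_trans _ h)// coord_le_norm.
by apply: norm_le_coord => // i; rewrite lE.
Qed.

Definition limit_field f (r : 'rV[R]_n) (d : R) (E : nat -> set R) F :=
  forall C : set 'rV[R]_n, compact C -> ~ C 0 -> forall e, 0 < e ->
    \forall k \near \oo, forall l, E k l -> forall v, C v ->
      `|rescaled_field f r d l v - F v| <= e.

(** After rescaling, this is [uniform_reach] from the unit ball to the box of
    size 1/2: the set [A] to be left consists of the points whose image by
    [dilation 2 r] has norm at least 1. *)
Lemma contraction f F r d (E : nat -> set R) :
  continuous F -> globally_attractive_origin F -> limit_field f r d E F ->
  (forall k l, E k l -> 0 < l) ->
  exists k (S : R), 0 < S /\ forall l x, E k l -> solution f +oo%E x ->
    box r l (x 0) -> exists2 t, 0 <= t <= S * l `^ (- d) & box r (l / 2) (x t).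
Proof.
move=> Fc Fa fF E0.
have Acl : closed [set v | 1 <= `|dilation 2 r v|].
  by apply: closed_norm_ge; exact: dilation_continuous.
have A0 : ~ [set v | 1 <= `|dilation 2 r v|] 0.
  by rewrite /= dilation0 normr0 ler10.
have [] := @uniform_reach F _ (fun k => rescaled_field f r d @` E k) 1 Fc Fa Acl A0.
  move=> C Cc C0 e e0; apply: filterS (fF C Cc C0 e e0) => k h _ [l El <-].
  exact: h.
move=> k [S [S0 hS]]; exists k, S; split => // l x El sx x0.
have l0 := E0 _ _ El.
have [||t /andP[t0 tS]] := hS _ _ _ (solution_rescaled r d l0 sx).
- by exists l.
- by rewrite mulr0.
move=> /negP; rewrite -ltNge dilationM ?invr_ge0 ?ltW// => xt.
exists (l `^ (- d) * t).
  by rewrite mulr_ge0 ?powR_ge0//= mulrC ler_wpM2r ?powR_ge0.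
by rewrite /box/= invfM invrK mulrC ltW.
Qed.

(** The time bound of each halving is written as a difference of values of
    [l |-> S / (2 ^ d - 1) * l ^ (- d)], so that the sum telescopes. For [d < 0]
    and [0 <= S] both the constant and the difference are nonpositive. *)
Lemma contraction_iter f r d (P : set R) (S : R) : d != 0 ->
  (forall l, P l -> 0 < l) ->
  (forall l x, P l -> solution f +oo%E x ->
    box r l (x 0) -> exists2 t, 0 <= t <= S * l `^ (- d) & box r (l / 2) (x t)) ->
  forall m l x, 0 < l -> (forall j, (j < m)%N -> P (l / 2 ^+ j)) ->
    solution f +oo%E x -> box r l (x 0) ->
    exists2 t, 0 <= t <= S / (2 `^ d - 1) * ((l / 2 ^+ m) `^ (- d) - l `^ (- d)) &
      box r (l / 2 ^+ m) (x t).
Proof.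
move=> d0 P0 step m l x l0; elim: m => [|m IH] Pl sx x0.
  by exists 0; rewrite expr0 divr1// subrr mulr0 lexx.
have [j jm|t /andP[t0 tS] xt] := IH _ sx x0.
  by apply: Pl; rewrite (leq_trans jm).
have Pm := Pl m (ltnSn m); have lm0 := P0 _ Pm.
have [|s /andP[s0 sS] xs] := step _ _ Pm (solution_shift t0 sx).
  by rewrite addr0.
have lE : l / 2 ^+ m.+1 = l / 2 ^+ m / 2 by rewrite exprSr invfM mulrA.
exists (t + s); last by rewrite lE.
rewrite addr_ge0//= (le_trans (lerD tS sS))// lE.
have n0 : 2 `^ d - 1 != 0 :> R.
  by rewrite subr_eq0 powR_eq1 (negPf d0) ltrn0 orbF pnatr_eq1.
have -> : (l / 2 ^+ m / 2) `^ (- d) = (l / 2 ^+ m) `^ (- d) * 2 `^ d.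
  rewrite powRM ?invr_ge0 ?ltW//; congr (_ * _).
  by rewrite -(powR_inv1 (ler0n _ 2)) -powRrM mulrNN mul1r.
set a := _ `^ (- d); set b := l `^ (- d); set q := 2 `^ d.
rewrite le_eqVlt; apply/orP; left; apply/eqP.
rewrite -/q in n0; field => //.
Qed.

End reach.

(** * The three regimes *)

Section regimes.
Context {R : realType} {n : nat}.
Implicit Types (f g F : 'rV[R]_n -> 'rV[R]_n) (x y : R -> 'rV[R]_n).

Definition scales0 (k : nat) : set R := [set l | 0 < l <= k.+1%:R^-1].
Definition scalesoo (k : nat) : set R := [set l | k.+1%:R <= l].

Lemma scales0_gt0 k l : scales0 k l -> 0 < l. Proof. by move=> /andP[]. Qed.
Lemma scalesoo_gt0 k l : scalesoo k l -> 0 < l.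
Proof. by apply: lt_le_trans; rewrite ltr0n. Qed.

Lemma limit_field_coord f r d E F :
  (forall i (C : set 'rV[R]_n), compact C -> ~ C 0 -> forall e, 0 < e ->
    \forall k \near \oo, forall l, E k l -> forall v, C v ->
      `|f (dilation l r v) 0 i / l `^ (d + r 0 i) - F v 0 i| <= e) ->
  limit_field f r d E F.
Proof.
move=> fF C Cc C0 e e0.
have : \forall k \near \oo, forall i, forall l, E k l -> forall v, C v ->
      `|f (dilation l r v) 0 i / l `^ (d + r 0 i) - F v 0 i| <= e.
  by apply: filter_forall => i; exact: fF.
apply: filterS => k h l El v Cv; apply: norm_le_coord => [|i]; first exact: ltW.
by rewrite !mxE; exact: h.
Qed.

Lemma limit_field0 f r d F : vf_homogeneous_0limit f r d F ->
  limit_field f r d scales0 F.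
Proof.
move=> [_ fF]; apply: limit_field_coord => i C Cc C0 e e0.
have [_ [_ _ _ _ /(_ C Cc C0 e e0)[l0 l00 hl0]]] := fF i.
have := near_infty_natSinv_lt (PosNum l00).
apply: filterS => k kl0 l /andP[l_gt0 lk]; apply: hl0.
by rewrite l_gt0 (le_trans lk)//; exact: ltW.
Qed.

Lemma limit_fieldoo f r d F : vf_homogeneous_oolimit f r d F ->
  limit_field f r d scalesoo F.
Proof.
move=> [_ fF]; apply: limit_field_coord => i C Cc C0 e e0.
have [_ [_ _ _ _ /(_ C Cc C0 e e0)[l0 l00 hl0]]] := fF i.
apply: filterS (nbhs_infty_ger l0) => k kl0 l kl; apply: hl0.
by rewrite (le_trans kl0)// (le_trans _ kl)// ler_nat.
Qed.

Lemma vf_homogeneous_oolimit_continuous f r d F : vf_homogeneous_oolimit f r d F ->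
  continuous f /\ continuous F.
Proof.
move=> [_ fF]; split; apply: continuous_rV => i.
  by have [_ []] := fF i.
by have [_ [_ _ _ [Fc _] _]] := fF i.
Qed.

Lemma vf_homogeneous_0limit_continuous f r d F : vf_homogeneous_0limit f r d F ->
  continuous F.
Proof.
move=> [_ fF]; apply: continuous_rV => i.
by have [_ [_ _ _ [Fc _] _]] := fF i.
Qed.

Lemma near_right0_halving (l : R) (P : set R) : 0 < l ->
  (\forall a \near (0 : R)^'+, P a) -> exists m, P (l / 2 ^+ m).
Proof.
move=> l0 /nbhs_ballP[e e0 eP].
have [m] := filter_ex (nbhs_infty_gtr (l / e)); rewrite ltr_pdivrMr// => lm.
have m0 : 0 < 2 ^+ m :> R by rewrite exprn_gt0.
exists m; apply: eP; last by rewrite divr_gt0.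
rewrite /ball/= sub0r normrN gtr0_norm ?divr_gt0// ltr_pdivrMr//.
apply: lt_le_trans lm _; rewrite (mulrC e) ler_pM2r// -natrX ler_nat ltnW//.
exact: ltn_expl.
Qed.

Lemma dilation_right0 r v : positive_weight r ->
  dilation a r v @[a --> 0^'+] --> (0 : 'rV[R]_n).
Proof.
move=> r0; apply: cvg_rV => i; rewrite mxE.
under eq_fun do rewrite mxE.
have : a `^ r 0 i * v 0 i @[a --> 0^'+] --> 0 * v 0 i.
  by apply: cvgMr_tmp; exact: powR_cvg0.
by rewrite mul0r.
Qed.

Lemma box_small (r : 'rV[R]_n) e : positive_weight r -> 0 < e ->
  \forall l \near (0 : R)^'+, forall v, box r l v -> `|v| <= e.
Proof.
move=> r0 e0.
have le : \forall l \near (0 : R)^'+, forall i, l `^ r 0 i <= e.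
  apply: filter_forall => i.
  apply: filterS ((cvgrPdist_le _ _).1 (powR_cvg0 (r0 i)) _ e0) => l.
  by rewrite sub0r normrN ger0_norm// powR_ge0.
apply: filterS2 (nbhs_right_gt 0) le => l l0 le v /(boxP _ _ l0) vl.
by apply: norm_le_coord => [|i]; [exact: ltW|rewrite (le_trans (vl i))].
Qed.

Lemma box_bounded (r : 'rV[R]_n) l : 0 < l ->
  exists M, forall v, box r l v -> `|v| <= M.
Proof.
move=> l0; exists (\sum_i l `^ r 0 i) => v /(boxP _ _ l0) vl.
apply: norm_le_coord => [|i]; first by apply: sumr_ge0 => i _; exact: powR_ge0.
apply: le_trans (vl i) _; rewrite (bigD1 i)//= lerDl.
by apply: sumr_ge0 => j _; exact: powR_ge0.
Qed.

Lemma box_nbhs0 (r : 'rV[R]_n) l : 0 < l ->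
  exists2 e, 0 < e & forall v, `|v| < e -> box r l v.
Proof.
move=> l0; have /cvgrPdist_le/(_ _ ltr01) := @dilation_continuous _ _ l^-1 r 0.
rewrite dilation0 => /nbhs_ballP[e e0 eP]; exists e => // v ve.
have := eP v; rewrite sub0r normrN; apply.
by rewrite -ball_normE /ball_/= sub0r normrN.
Qed.

Lemma powR2_gt1 (d : R) : 0 < d -> 1 < 2 `^ d.
Proof.
move=> d0; have := gt0_ltr_powR d0 (x := 1) (y := 2).
by rewrite powR1 !nnegrE ltr1n; apply.
Qed.

(** As [d > 0], the quantity [l ^ (- d)] is positive and may be dropped from the
    telescoped time bound: what remains depends only on the final box. *)
Lemma reach_box f r d F : vf_homogeneous_oolimit f r d F ->
  globally_attractive_origin F -> 0 < d ->
  exists l T, [/\ 0 < l, 0 < T & forall x, solution f +oo%E x ->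
    exists2 t, 0 <= t <= T & box r l (x t)].
Proof.
move=> fF Fa d0; have [_ Fc] := vf_homogeneous_oolimit_continuous fF.
have [k [S [S0 step]]] := contraction Fc Fa (limit_fieldoo fF) scalesoo_gt0.
have iter := @contraction_iter _ _ f r d (scalesoo k) S (lt0r_neq0 d0)
  (@scalesoo_gt0 k) step.
have l0 : 0 < k.+1%:R :> R by rewrite ltr0n.
have c0 : 0 < S / (2 `^ d - 1).
  by rewrite divr_gt0// subr_gt0 powR2_gt1.
exists k.+1%:R, (S / (2 `^ d - 1) * k.+1%:R `^ (- d)); split => //.
  by rewrite mulr_gt0// powR_gt0.
move=> x sx.
have [m xm] : exists m, `|dilation (k.+1%:R^-1 / 2 ^+ m) r (x 0)| <= 1.
  apply: (near_right0_halving (P := fun a => `|dilation a r (x 0)| <= 1)).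
    by rewrite invr_gt0.
  have /cvgrPdist_le/(_ _ ltr01) := @dilation_right0 r (x 0) fF.1.
  by apply: filterS => a; rewrite sub0r normrN.
have m0 j : 2 ^+ j != 0 :> R by rewrite expf_neq0.
have [||||t /andP[t0 tT] xt] := iter m (k.+1%:R * 2 ^+ m) x.
- by rewrite mulr_gt0// exprn_gt0.
- move=> j jm; rewrite /scalesoo/= ler_pdivlMr ?exprn_gt0// ler_pM2l//.
  by rewrite ler_weXn2l ?ler1n// ltnW.
- by [].
- by rewrite /box/= invfM.
rewrite mulfK// in tT xt.
exists t => //; rewrite t0 (le_trans tT)// ler_pM2l// gerBl.
exact: powR_ge0.
Qed.

(** As [d < 0], now the contribution of the final box may be dropped, so every
    box of size [l / 2 ^ m] is met before the same time [T]; the minimum of the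
    norm over [[0, T]] is then 0. *)
Lemma reach_zero f r d F : vf_homogeneous_0limit f r d F ->
  globally_attractive_origin F -> d < 0 ->
  exists l T, [/\ 0 < l, 0 < T & forall x, solution f +oo%E x -> box r l (x 0) ->
    exists2 t, 0 <= t <= T & x t = 0].
Proof.
move=> fF Fa d0; have Fc := vf_homogeneous_0limit_continuous fF.
have [k [S [S0 step]]] := contraction Fc Fa (limit_field0 fF) scales0_gt0.
have iter := @contraction_iter _ _ f r d (scales0 k) S (ltr0_neq0 d0)
  (@scales0_gt0 k) step.
pose l : R := k.+1%:R^-1; have l0 : 0 < l by rewrite invr_gt0 ltr0n.
have c0 : 0 < S / (1 - 2 `^ d).
  rewrite divr_gt0// subr_gt0 -[d]opprK powRN invf_lt1 ?powR_gt0//.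
  by rewrite powR2_gt1// oppr_gt0.
pose T := S / (1 - 2 `^ d) * l `^ (- d).
have T0 : 0 < T by rewrite mulr_gt0// powR_gt0.
exists l, T; split => // x sx x0.
have reach m : exists2 t, 0 <= t <= T & box r (l / 2 ^+ m) (x t).
  have [||||t /andP[t0 tT] xt] := iter m l x => //.
    move=> j jm; apply/andP; split; first by rewrite divr_gt0// exprn_gt0.
    rewrite ler_pdivrMr ?exprn_gt0// ler_peMr//; first exact: ltW.
    by apply: exprn_ege1; rewrite ler1n.
  exists t => //; rewrite t0 (le_trans tT)//.
  rewrite /T -(opprB 1) invrN mulrN mulNr -mulrN opprB ler_pM2l// gerBl.
  exact: powR_ge0.
have xc : {within `[0, T], continuous (fun t => `|x t|)}.
  have /subspace_continuousP xc := solution_continuous sx (lexx 0) (ltry T).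
  by apply/subspace_continuousP => t tT; apply: cvg_norm; exact: xc.
have [t] := EVT_min (ltW T0) xc.
rewrite in_itv/= => tT tmin; exists t => //.
apply/eqP; rewrite -normr_le0 leNgt; apply/negP => xt0.
have xt2 : 0 < `|x t| / 2 by rewrite divr_gt0.
have [m hm] := near_right0_halving l0 (box_small fF.1 xt2).
have [s sT xs] := reach m.
have := tmin s; rewrite in_itv/= => /(_ sT); have := hm _ xs; lra.
Qed.

Lemma reach_between f (r r' : 'rV[R]_n) l l' : continuous f ->
  globally_attractive_origin f -> 0 < l -> 0 < l' ->
  exists2 T, 0 < T & forall x, solution f +oo%E x -> box r l (x 0) ->
    exists2 t, 0 <= t <= T & box r' l' (x t).
Proof.
move=> fc fa l0 l'0.
have [M lM] := box_bounded r l0; have [e e0 el'] := box_nbhs0 r' l'0.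
have [|||||k [T [T0 hT]]] := @uniform_reach _ _ f [set v | e <= `|v|]
    (fun=> [set f]) M.
- exact: fc.
- exact: fa.
- by apply: (@closed_norm_ge _ _ id) => v; exact: cvg_id.
- by rewrite /= normr0; apply/negP; rewrite -ltNge.
- move=> C _ _ d d0; apply: nearW => k g -> v _.
  by rewrite subrr normr0 ltW.
exists T => // x sx xl; have [t tT /negP] := hT f x erefl sx (lM _ xl).
by rewrite -ltNge => /el'; exists t.
Qed.

Lemma stable_origin_stays f x (t0 t : R) : stable_origin f -> solution f +oo%E x ->
  0 <= t0 -> t0 <= t -> x t0 = 0 -> x t = 0.
Proof.
move=> fs sx t00 t0t xt0; apply/eqP; rewrite -normr_le0.
apply/ler_addgt0Pr => e e0; rewrite add0r.
have [d d0 hd] := fs _ e0.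
have := hd _ _ (solution_shift t00 sx).
rewrite addr0 xt0 normr0 => /(_ d0 (t - t0)); rewrite (addrC t0) subrK => h.
apply/ltW/h.
by split; [rewrite subr_ge0|rewrite ltry].
Qed.

End regimes.

(** * Uniform finite-time convergence *)

Theorem corollary2p24 (R : realType) (n : nat)
    (f : 'rV[R]_n -> 'rV[R]_n)
    (r0 : 'rV[R]_n) (d0 : R) (f0 : 'rV[R]_n -> 'rV[R]_n)
    (roo : 'rV[R]_n) (doo : R) (foo : 'rV[R]_n -> 'rV[R]_n)
    (hf : vf_homogeneous_bilimit f r0 d0 f0 roo doo foo)
    (gas_f : globally_asymptotically_stable_origin f)
    (gas_foo : globally_asymptotically_stable_origin foo)
    (gas_f0 : globally_asymptotically_stable_origin f0)
    (hdoo : 0 < doo) (hd0 : d0 < 0) :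
  exists2 T : R, 0 < T &
    forall (b : \bar R) (x : R -> 'rV[R]_n), maximal_solution f b x ->
      b = +oo%E /\ forall t : R, T <= t -> x t = 0.
Proof.
have [hf0 hfoo] := hf; have [_ fs fa] := gas_f.
have [_ _ fooa] := gas_foo; have [_ _ f0a] := gas_f0.
have [fc _] := vf_homogeneous_oolimit_continuous hfoo.
have [l1 [T1 [l10 T10 reach1]]] := reach_box hfoo fooa hdoo.
have [l2 [T2 [l20 T20 reach2]]] := reach_zero hf0 f0a hd0.
have [T3 T30 reach3] := @reach_between _ _ f roo r0 l1 l2 fc fa l10 l20.
exists (T1 + T3 + T2); first by rewrite !addr_gt0.
move=> b x mx; have [bE _] := fa _ _ mx; split => // t Tt.
have sx : solution f +oo%E x by rewrite -bE; case: mx.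
have [t1 /andP[t10 t1T] x1] := reach1 x sx.
have sx1 := solution_shift t10 sx.
have [|t3 /andP[t30 t3T] x3] := reach3 _ sx1; first by rewrite addr0.
have sx3 := solution_shift t30 sx1.
have [|t2 /andP[t20 t2T] x2] := reach2 _ sx3; first by rewrite addr0.
apply: (stable_origin_stays fs sx _ _ x2); first by rewrite !addr_ge0.
by lra.
Qed.
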